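(* Let $q=2^h$ with $h\geq1$ odd. The $\mathbb{F}_q$-subspace \[U:=\{(x,\,y,\,x^{q^2}+y^{q},\,x^{q}+y^{q^3}) : x,y\in\mathbb{F}_{q^6},\ \mathrm{Tr}_{q^6/q^2}(x)=\mathrm{Tr}_{q^6/q^2}(y)=0\}\] of $\mathbb{F}_{q^6}^4$ is scattered, i.e. every $1$-dimensional $\mathbb{F}_{q^6}$-subspace of $\mathbb{F}_{q^6}^4$ meets $U$ in an $\mathbb{F}_q$-subspace of dimension at most $1$.
   Context: $\mathrm{Tr}_{q^6/q^2}(x)=x+x^{q^2}+x^{q^4}$. *)

(* Defs.v *)
From HB Require Import structures.
From mathcomp Require Import all_boot all_order all_algebra all_field.

Set Implicit Arguments.
Unset Strict Implicit.
Unset Printing Implicit Defensive.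

Import GRing.Theory.
Local Open Scope ring_scope.

(* The space L^n, for L a finite extension of F, carries two vector space
   structures: {ffun 'I_n -> L} is the F-vector space and {ffun 'I_n -> L^o}
   the L-vector space; the two carriers are convertible. *)
Section Scattered.

Variables (F : fieldType) (L : fieldExtType F) (n : nat).

Definition restrict_scalars (W : {vspace {ffun 'I_n -> L^o}}) :
    {vspace {ffun 'I_n -> L}} :=
  <<[seq (a *: w)%R : {ffun 'I_n -> L}
      | a : L <- vbasis {:L}, w : {ffun 'I_n -> L^o} <- vbasis W]>>%VS.

Lemma mem_restrict_scalars (W : {vspace {ffun 'I_n -> L^o}})
    (v : {ffun 'I_n -> L}) :
  (v \in restrict_scalars W) = ((v : {ffun 'I_n -> L^o}) \in W).
Proof.
apply/idP/idP.
- rewrite /restrict_scalars; set s := (X in <<X>>%VS) => sv.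
  rewrite [v](@coord_span _ _ _ (in_tuple s)) //.
  apply: (big_ind (fun u : {ffun 'I_n -> L} => (u : {ffun 'I_n -> L^o}) \in W)).
  + have -> : (0 : {ffun 'I_n -> L}) = (0 : {ffun 'I_n -> L^o}) :> {ffun 'I_n -> L}.
      by apply/ffunP=> i; rewrite !ffunE.
    exact: mem0v.
  + move=> x y Wx Wy.
    have -> : x + y = (x : {ffun 'I_n -> L^o}) + y :> {ffun 'I_n -> L}.
      by apply/ffunP=> i; rewrite !ffunE.
    exact: memvD.
  + move=> j _; set c := coord _ _ _.
    have /allpairsP[[a w] /= [_ Ww def_w]] := mem_nth (0 : {ffun 'I_n -> L}) (ltn_ord j : (j < size s)%N).
    rewrite /= def_w.
    have -> : c *: (a *: w : {ffun 'I_n -> L}) = (c *: a) *: w :> {ffun 'I_n -> L^o}.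
      by apply/ffunP=> i; rewrite !ffunE /= scalerAl.
    by rewrite memvZ // vbasis_mem.
- move=> Wv; rewrite (coord_vbasis Wv).
  apply: (big_ind (fun u : {ffun 'I_n -> L^o} =>
    (u : {ffun 'I_n -> L}) \in restrict_scalars W)).
  + have -> : (0 : {ffun 'I_n -> L^o}) = (0 : {ffun 'I_n -> L}) :> {ffun 'I_n -> L}.
      by apply/ffunP=> i; rewrite !ffunE.
    exact: mem0v.
  + move=> x y Wx Wy.
    have -> : x + y = (x : {ffun 'I_n -> L}) + y :> {ffun 'I_n -> L}.
      by apply/ffunP=> i; rewrite !ffunE.
    exact: memvD.
  + move=> j _; set c := coord _ _ _; set w := (vbasis W)`_j.
    have Ww : w \in (vbasis W : seq _) by rewrite mem_nth ?size_tuple.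
    have -> : c *: w = \sum_k coord (vbasis {:L}) k c
        *: ((vbasis {:L})`_k *: w : {ffun 'I_n -> L}) :> {ffun 'I_n -> L}.
      apply/ffunP=> i; rewrite sum_ffunE !ffunE /=.
      rewrite [LHS](_ : _ = c * w i) //.
      rewrite {1}(coord_vbasis (memvf c)) mulr_suml.
      by apply: eq_bigr => k _; rewrite !ffunE scalerAl.
    apply: memv_suml => k _; apply/memvZ/memv_span.
    by apply/allpairsP; exists ((vbasis {:L})`_k, w); split=> //=; rewrite mem_nth ?size_tuple.
Qed.

Definition scattered (U : {vspace {ffun 'I_n -> L}}) : Prop :=
  forall W : {vspace {ffun 'I_n -> L^o}},
    \dim W = 1%N -> (\dim (U :&: restrict_scalars W) <= 1)%N.

End Scattered.

Section U.

Variables (L : fieldType) (q : nat).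

Definition trace_q6_q2 (x : L) : L := x + x ^+ (q ^ 2) + x ^+ (q ^ 4).

Definition vecU (x y : L) : {ffun 'I_4 -> L} :=
  [ffun i : 'I_4 =>
     [:: x; y; x ^+ (q ^ 2) + y ^+ q; x ^+ q + y ^+ (q ^ 3)]`_i].

Definition in_U (v : {ffun 'I_4 -> L}) : Prop :=
  exists x y : L, [/\ trace_q6_q2 x = 0, trace_q6_q2 y = 0 & v = vecU x y].

End U.

(* Main.v *)
From HB Require Import structures.
Require Import Defs.
From mathcomp Require Import all_boot all_order all_algebra all_field.
From mathcomp Require Import ring.

Import GRing.Theory.
Local Open Scope ring_scope.

(** Write [f] for the [q]-Frobenius and [z_i] for its [i]-th iterate at [z].  Let
    [(x, y) != 0] and suppose that [l] scales the vector of [(x, y)] to a vector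
    of [U].  If [l] is in F_{q^2}, the last two coordinates give [l_1 = l] at
    once.  Otherwise the trace conditions on [x] and [l x] force [x = m a] and
    [y = n a], with [a := l_2 + l_4] and [m], [n] in F_{q^2}.  Comparing the
    conjugates of the two remaining equations then gives, with [P := m m_1] and
    [Q := n n_1] in F_q, [P = m n_1 + m_1 n] and
    [Q^2 = (m n_1)^2 + (m_1 n)^2 + P Q], so [P^2 + P Q + Q^2 = 0]: this is
    impossible because F_q has no primitive cube root of unity, [h] being odd. *)

(** This and its two-equation variant turn an elimination into one [ring] goal: the coefficients
    certify the combination. Passing [2 = 0] as an equation lets [ring] work in characteristic 2. *)
Lemma eq_lincomb {R : pzRingType} (k : R) {l r x y : R} :
  l = r -> x - y = k * (l - r) -> x = y.
Proof. by move=> ->; rewrite subrr mulr0 => /subr0_eq. Qed.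

Lemma eq_lincomb2 {R : pzRingType} (k k' : R) {l r l' r' x y : R} :
  l = r -> l' = r' -> x - y = k * (l - r) + k' * (l' - r') -> x = y.
Proof. by move=> -> ->; rewrite !subrr !mulr0 addr0 => /subr0_eq. Qed.

(** The case of [l] outside F_{q^2}, with x = m a and y = n a. Eliminating [b0] and [c], and then
    the conjugates of [a], leaves relations in [m], [n] and their conjugates alone. *)
Lemma conjugates_quadratic (L : fieldType) (f : {rmorphism L -> L})
    (l m n : L) :
    2%N \in [pchar L] -> (forall x, f (f (f (f (f (f x))))) = x) ->
    f (f l) != l -> f (f m) = m -> f (f n) = n -> m != 0 -> n != 0 ->
    let a := f (f l) + f (f (f (f l))) in
    (l + f (f l)) * f (f (m * a)) = (l + f l) * f (n * a) ->
    (l + f l) * f (m * a) = (l + f (f (f l))) * f (f (f (n * a))) ->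
  exists P Q, [/\ f P = P, f Q = Q, P != 0, Q != 0 & P ^+ 2 = P * Q + Q ^+ 2].
Proof.
move=> ch2 f6 l2_neq fm2 fn2 m0 n0 a.
have cancel2 (u v w : L) : (u + v) + (v + w) = u + w.
  by rewrite addrA -[u + v + v]addrA (addrr_pchar2 ch2) addr0.
have nz_f (u : L) : u != 0 -> f u != 0 by rewrite fmorph_eq0.
pose a1 := f a; pose a2 := f a1; pose a3 := f a2.
pose a4 := f a3; pose a5 := f a4.
pose b0 := l + f l; pose b1 := f b0; pose b2 := f b1; pose c := l + f (f (f l)).
pose m' := f m; pose n' := f n.
have a4E : a4 = l + f (f l) by rewrite /a4 /a3 /a2 /a1 /a !rmorphD !f6.
have a2E : a2 = f (f (f (f l))) + l by rewrite /a2 /a1 /a !rmorphD !f6.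
have a5f : f a5 = a by rewrite /a5 /a4 /a3 /a2 /a1 f6.
have a40 : a4 != 0.
  by rewrite a4E addr_eq0 (oppr_pchar2 ch2) eq_sym.
have a_0 : a != 0 by rewrite -a5f; exact/nz_f/nz_f.
have a20 : a2 != 0 by do !apply/nz_f.
have m'0 : m' != 0 by apply/nz_f.
have n'0 : n' != 0 by apply/nz_f.
(* Since a_4 = l + l_2 and a_2 = l + l_4, these sums telescope in characteristic 2. *)
have bD : b0 + b1 = a4 by rewrite a4E /b1 /b0 rmorphD cancel2.
have aD : a4 + a = a2 by rewrite a2E a4E /a cancel2 addrC.
have cE : c = a4 + b2 by rewrite a4E /b2 /b1 /b0 !rmorphD cancel2.
have c3 : f (f (f c)) = c by rewrite /c !rmorphD f6 addrC.
have fm' : f m' = m by []. have fn' : f n' = n by [].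
rewrite !rmorphM fm2 fn2 -/m' -/n' -/a1 -/a2 -/a3 -a4E -/b0 -/c.
move=> E1 E2.
have E1f : a5 * (m' * a3) = b1 * (n * a2).
  by have := congr1 f E1; rewrite !rmorphM fn'.
have E1ff : a * (m * a4) = b2 * (n' * a3).
  by have := congr1 f E1f; rewrite !rmorphM fm' a5f.
(* The term in [b0] is common to m' E1 and n' E2. As f^3 fixes [c], applying f^3 then gives a second
   equation with the same [c]. *)
have E3 : m * m' * (a2 * a4) = c * n' ^+ 2 * a3.
  by apply: (eq_lincomb2 m' n' E1 E2); ring.
have E3f : m' * m * (a5 * a1) = c * n ^+ 2 * a.
  have := congr1 (fun z => f (f (f z))) E3.
  by rewrite !(rmorphM, rmorphXn) c3 -/m' !fm' !fn' -/m' -/a3 -/a4 -/a5 a5f -/a1.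
(* Cross-multiplying [E3] and [E3f] eliminates [c]. *)
have NM : a * a2 * a4 * n ^+ 2 = a1 * a3 * a5 * n' ^+ 2.
  apply: (mulfI (mulf_neq0 m0 m'0)).
  by apply: (eq_lincomb2 (a * n ^+ 2) (- (n' ^+ 2 * a3)) E3 E3f); ring.
(* Splitting a_4 as b_0 + b_1 brings in [E1] and [E1f]; [NM] then removes the product a_1 a_3
   a_5. *)
have D0 : a1 * n' ^+ 2 = m * n' * a2 + m' * n * a.
  apply: (mulfI (mulf_neq0 (mulf_neq0 (mulf_neq0 a_0 a20) a40) n0)).
  have H : a * a1 * a2 * a4 * n * n' =
      a * a2 ^+ 2 * a4 * m * n + a * a1 * a3 * a5 * m' * n'.
    rewrite -{1}bD.
    by apply: (eq_lincomb2 (- (a * a2 * n)) (- (a * a1 * n')) E1 E1f); ring.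
  by apply: (eq_lincomb2 n' (- (m' * a)) H NM); ring.
have D1 : a2 * n ^+ 2 = m' * n * a3 + m * n' * a1.
  by have := congr1 f D0; rewrite rmorphD !rmorphM fm' fn'.
have D2 : a3 * n' ^+ 2 = m * n' * a4 + m' * n * a2.
  by have := congr1 f D1; rewrite rmorphD !rmorphM fm' fn'.
(* Writing c = a_4 + b_2 in [E3] and replacing the b_2 term by [E1ff] lets a_4 cancel; after [D2],
   the sum a_4 + a is a_2, which cancels too. *)
have mmE : m * m' = m * n' + m' * n.
  apply: (mulfI a20); apply: (mulfI a40).
  rewrite -[X in a4 * (X * (_ + _))]aD.
  rewrite cE in E3.
  have H : a4 * (a2 * (m * m')) = a4 * (a3 * n' ^+ 2) + a * m * a4 * n'.
    by apply: (eq_lincomb2 1 (- n') E3 E1ff); ring.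
  rewrite H D2 -aD; ring.
have nnE : (n * n') ^+ 2 = (m * n') ^+ 2 + (m' * n) ^+ 2 + m * m' * (n * n').
  apply: (mulfI a20).
  have -> : a2 * (n * n') ^+ 2 = a2 * n ^+ 2 * n' ^+ 2 by ring.
  have -> : a2 * n ^+ 2 * n' ^+ 2 =
      m' * n * (a3 * n' ^+ 2) + m * n' * (a1 * n' ^+ 2).
    by rewrite D1; ring.
  rewrite D0 D2 -aD; ring.
exists (m * m'), (n * n'); split; rewrite ?mulf_neq0 //.
- by rewrite rmorphM fm' mulrC.
- by rewrite rmorphM fn' mulrC.
(* The cross term 2 (m n')(m' n) of the square is 2 P Q, matching the two copies of P Q on the
   right. *)
by rewrite nnE {1}mmE; ring.
Qed.

(** In characteristic 2 the equation forces P^3 = Q^3. For odd h, 2^h is 2 modulo 3, so cubing is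
    injective on nonzero fixed elements and P = Q, whence Q^2 = 0. *)
Lemma quadratic_neq_of_fixed (L : fieldType) (h : nat) (P Q : L) :
    2%N \in [pchar L] -> odd h ->
    P ^+ (2 ^ h) = P -> Q ^+ (2 ^ h) = Q -> P != 0 -> Q != 0 ->
  P ^+ 2 <> P * Q + Q ^+ 2.
Proof.
move=> ch2 oh fP fQ P0 Q0 E.
have PQ3 : P ^+ 3 = Q ^+ 3.
  have two0 : 2%:R = 0 :> L by apply: pcharf0.
  apply: (eq_lincomb2 (P - Q) (P ^+ 2 * Q - Q ^+ 3) E two0); ring.
have [k q3] : exists k, (2 ^ h = 3 * k + 2)%N.
  exists (2 ^ h %/ 3)%N; rewrite [LHS](divn_eq _ 3) mulnC; congr addn.
  rewrite -(odd_double_half h) oh add1n -mul2n expnS expnM.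
  by rewrite -modnMmr -modnXm exp1n.
have : P * Q ^+ (2 ^ h) = Q * P ^+ (2 ^ h).
  by rewrite fP fQ mulrC.
rewrite q3 !(exprD _ (3 * k)%N) !exprM PQ3 => H.
have PQ : P = Q.
  have K : Q ^+ 3 ^+ k * P * Q != 0 by rewrite !mulf_neq0 ?expf_neq0.
  by apply: (mulfI K); apply: (eq_lincomb (-1) H); ring.
move: E; rewrite PQ -expr2 => /eqP; rewrite -subr_eq0 opprD addNKr oppr_eq0.
by rewrite expf_eq0 (negPf Q0).
Qed.

Lemma scalar_Frobenius_fixed (L : fieldType) (f : {rmorphism L -> L})
    (l x y : L) :
    2%N \in [pchar L] -> (forall z, f (f (f (f (f (f z))))) = z) ->
    (forall P Q, f P = P -> f Q = Q -> P != 0 -> Q != 0 ->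
      P ^+ 2 <> P * Q + Q ^+ 2) ->
    let tr z := z + f (f z) + f (f (f (f z))) in
    tr x = 0 -> tr y = 0 -> tr (l * x) = 0 -> tr (l * y) = 0 ->
    l * (f (f x) + f y) = f (f (l * x)) + f (l * y) ->
    l * (f x + f (f (f y))) = f (l * x) + f (f (f (l * y))) ->
  (x != 0) || (y != 0) -> f l = l.
Proof.
move=> ch2 f6 noroot tr trX trY trlx trly E1 E2 xy0.
apply/eqP; apply: contraT => l1_neq.
have chD (u v : L) : (u + v == 0) = (u == v) by rewrite addr_eq0 oppr_pchar2.
have two0 : 2%:R = 0 :> L by apply: pcharf0.
have b0 : l + f l != 0 by rewrite chD eq_sym.
have {}E1 : (l + f (f l)) * f (f x) = (l + f l) * f y.
  move: E1; rewrite !rmorphM => E1.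
  by apply: (eq_lincomb2 1 (f (f l) * f (f x) - l * f y) E1 two0); ring.
have {}E2 : (l + f l) * f x = (l + f (f (f l))) * f (f (f y)).
  move: E2; rewrite !rmorphM => E2.
  by apply: (eq_lincomb2 1 (f l * f x - l * f (f (f y))) E2 two0); ring.
have [l2|l2_neq] := eqVneq (f (f l)) l.
  rewrite l2 (addrr_pchar2 ch2) mul0r in E1.
  have y0 : y = 0.
    move/esym/eqP: E1; rewrite mulf_eq0 (negPf b0) fmorph_eq0 /=.
    by move/eqP.
  move/eqP: E2; rewrite y0 !rmorph0 mulr0 mulf_eq0 (negPf b0) fmorph_eq0 /=.
  by move=> x0; rewrite y0 x0 eqxx in xy0.
pose a := f (f l) + f (f (f (f l))).
have a0 : a != 0 by rewrite chD !(inj_eq (fmorph_inj f)) eq_sym.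
(* Adding l_4 tr(z) to tr(l z) cancels z_4 and leaves (l + l_4) z = (l_2 + l_4) z_2, that is, a_2 z
   = a z_2. *)
have quot z : tr z = 0 -> tr (l * z) = 0 -> f (f (z / a)) = z / a.
  rewrite /tr !rmorphM !fmorphV => trz trlz.
  have fa0 : f (f a) != 0 by rewrite !fmorph_eq0.
  apply: (mulIf a0); rewrite divfK //; apply: (mulIf fa0).
  rewrite mulrAC divfK //.
  have faE : f (f a) = f (f (f (f l))) + l by rewrite /a !rmorphD f6.
  have trlz4 : tr (l * z) + f (f (f (f l))) * tr z = 0.
    by rewrite /tr !rmorphM trlz trz mulr0 addr0.
  rewrite /tr !rmorphM in trlz4; set z4 := f (f (f (f z))) in trlz4.
  apply: (eq_lincomb2 1 (- (l * z + f (f (f (f l))) * (z + z4))) trlz4 two0).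
  by rewrite faE /a; ring.
have := conjugates_quadratic L f l (x / a) (y / a) ch2 f6 l2_neq
  (quot x trX trlx) (quot y trY trly).
rewrite /= -/a !divfK //.
(* Because l + l_1 is nonzero, [E1] and [E2] make each of [x], [y] vanish with the other. *)
have [x0|x0] := eqVneq x 0.
  move/esym/eqP: E1; rewrite x0 !rmorph0 mulr0 mulf_eq0 (negPf b0) fmorph_eq0 /=.
  by move=> y0; rewrite y0 x0 eqxx in xy0.
have [y0|y0] := eqVneq y 0.
  move/esym/eqP: E2; rewrite y0 !rmorph0 mulr0 eq_sym mulf_eq0 (negPf b0).
  by rewrite fmorph_eq0 (negPf x0).
rewrite !mulf_neq0 ?invr_eq0 // => /(_ isT isT E1 E2)[P [Q [fP fQ P0 Q0]]].
by move/(noroot _ _ fP fQ P0 Q0).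
Qed.

Lemma Frobenius_rmorphism (R : comNzRingType) (p h : nat) :
  p \in [pchar R] -> exists f : {rmorphism R -> R}, forall x, f x = x ^+ (p ^ h).
Proof.
move=> pcharRp; pose f (x : R) := x ^+ (p ^ h).
have p_gt0 : (0 < p)%N by rewrite prime_gt0 ?(pcharf_prime pcharRp).
have fD : nmod_morphism f.
  split=> [|x y]; rewrite /f; first by rewrite expr0n expn_eq0 eqn0Ngt p_gt0.
  by apply: exprDn_pchar; rewrite pnatX pnatE ?pcharRp ?(pcharf_prime pcharRp).
have fM : monoid_morphism f by split=> [|x y]; rewrite /f ?expr1n ?exprMn.
pose fN := GRing.isNmodMorphism.Build R R f fD.
pose fR := GRing.isMonoidMorphism.Build R R f fM.
pose g : {rmorphism R -> R} := HB.pack f fN fR.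
by exists g.
Qed.

Lemma expr_exp_iter {R : pzRingType} {f : R -> R} {q : nat} :
  (forall x, f x = x ^+ q) -> forall i x, x ^+ (q ^ i) = iter i f x.
Proof. by move=> fE i x; elim: i => //= i <-; rewrite fE -exprM -expnSr. Qed.

(** The map whose kernel is U; its linearity over F_q makes U a [vspace]. *)
Definition U_equations (L : fieldType) (f : L -> L) (v : {ffun 'I_4 -> L}) :
    {ffun 'I_4 -> L} :=
  let tr x := x + f (f x) + f (f (f (f x))) in
  let x := v (@Ordinal 4 0 isT) in let y := v (@Ordinal 4 1 isT) in
  [ffun i : 'I_4 => [:: tr x; tr y;
     f (f x) + f y - v (@Ordinal 4 2 isT);
     f x + f (f (f y)) - v (@Ordinal 4 3 isT)]`_i].

Lemma U_equations_linear (F : fieldType) (L : fieldExtType F)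
    (f : {rmorphism L -> L}) :
  (forall (k : F) x, f (k *: x) = k *: f x) -> linear (U_equations L f).
Proof.
move=> fZ k u v; apply/ffunP=> -[[|[|[|[|//]]]] lti]; rewrite !ffunE /= ?ffunE.
all: rewrite !(rmorphD, fZ) /= !scalerDr ?scalerN.
all: ring.
Qed.

Lemma U_equations_eq0 (L : fieldType) (f : {rmorphism L -> L}) (q : nat) v :
  (forall x, f x = x ^+ q) -> (U_equations L f v == 0) <-> in_U q v.
Proof.
move=> fE.
have f2 := expr_exp_iter fE 2; have f3 := expr_exp_iter fE 3.
have f4 := expr_exp_iter fE 4; rewrite /= in f2 f3 f4.
split=> [/eqP/ffunP Uv | [x [y [trX trY ->]]]].
  exists (v (@Ordinal 4 0 isT)), (v (@Ordinal 4 1 isT)).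
  have := Uv (@Ordinal 4 0 isT); have := Uv (@Ordinal 4 1 isT).
  have := Uv (@Ordinal 4 2 isT); have := Uv (@Ordinal 4 3 isT).
  rewrite !ffunE /= => /subr0_eq v3 /subr0_eq v2 v1 v0.
  rewrite /trace_q6_q2 !f2 !f4; split=> //.
  by apply/ffunP=> -[[|[|[|[|//]]]] lti]; rewrite ffunE /= ?f2 ?f3 -?fE
    (bool_irrelevance lti isT).
apply/eqP/ffunP=> -[[|[|[|[|//]]]] lti]; rewrite !ffunE /= ?ffunE /= -?f4 -?f3 -?f2.
- exact: trX.
- exact: trY.
- by rewrite fE subrr.
- by rewrite fE subrr.
Qed.

(** An L-line meeting U in some nonzero [v] is L v. If only scalars from F keep [v] in U, the
    intersection lies in F v. *)
Lemma scattered_of_scalars (F : fieldType) (L : fieldExtType F) (n : nat)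
    (U : {vspace {ffun 'I_n -> L}}) :
  (forall (l : L) (v w : {ffun 'I_n -> L}), v \in U -> w \in U -> v != 0 ->
     (forall i, w i = l * v i) -> l \in 1%VS) -> scattered U.
Proof.
move=> scalU W dimW; set V := (U :&: _)%VS.
have [->|] := eqVneq V 0%VS; first by rewrite dimv0.
rewrite -vpick0; set v := vpick V => v0.
have : v \in V := memv_pick V.
rewrite memv_cap => /andP[Uv]; rewrite mem_restrict_scalars => Wv.
suff /dimvS/leq_trans : (V <= <[v]>)%VS by apply; rewrite dim_vline leq_b1.
apply/subvP=> w; rewrite memv_cap => /andP[Uw]; rewrite mem_restrict_scalars => Ww.
have defW : W = <[v : {ffun 'I_n -> L^o}]>%VS.
  apply/esym/eqP; rewrite eqEdim -memvE Wv dim_vline dimW.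
  by rewrite [_ != _]v0.
move: Ww; rewrite defW => /vlineP[l wE].
have wi i : w i = l * v i by rewrite wE !ffunE.
have /vlineP[k lE] := scalU l v w Uv Uw v0 wi.
apply/vlineP; exists k; apply/ffunP=> i.
by rewrite ffunE wi lE mulr_algl.
Qed.

Theorem theorem2p1 (h q : nat) (F : finFieldType) (L : fieldExtType F)
    (h_ge1 : (1 <= h)%N) (h_odd : odd h) (q_def : q = (2 ^ h)%N)
    (cardF : #|F| = q) (dimL : \dim {:L} = 6%N) :
  exists2 U : {vspace {ffun 'I_4 -> L}},
    (forall v : {ffun 'I_4 -> L}, v \in U <-> in_U q v) & scattered U.
Proof.
have ch2 : 2%N \in [pchar L].
  by rewrite pchar_lalg; apply: (card_finPcharP (etrans cardF q_def)).
have [f] := Frobenius_rmorphism L 2 h ch2; rewrite -q_def => fE.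
(* Fermat's little theorem is applied to F_q, the fixed field of [f], and then to L, of order
   q^6. *)
have f_id x : (f x == x) = (x \in 1%VS).
  by rewrite (Fermat's_little_theorem 1%AS) dimv1 expn1 cardF fE.
have f6 x : f (f (f (f (f (f x))))) = x.
  have := memvf x; rewrite (Fermat's_little_theorem {:L}%AS) dimL cardF.
  by rewrite (expr_exp_iter fE) => /eqP.
have fZ (k : F) x : f (k *: x) = k *: f x.
  rewrite -mulr_algl rmorphM -[RHS]mulr_algl; congr (_ * _).
  by apply/eqP; rewrite f_id memvZ ?mem1v.
pose gM := GRing.isLinear.Build F _ _ _ (U_equations L f)
  (U_equations_linear _ _ _ fZ).
pose g : {linear {ffun 'I_4 -> L} -> {ffun 'I_4 -> L}} :=
  HB.pack (U_equations L f) gM.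
have memU v : v \in lker (linfun g) <-> in_U q v.
  by rewrite memv_ker lfunE; apply: U_equations_eq0.
exists (lker (linfun g)) => //.
apply: scattered_of_scalars => l v w.
move=> /memU[x [y [trX trY ->]]] /memU[x' [y' [trX' trY' ->]]] v0 lv.
(* The first two coordinates give x' = l x and y' = l y; the other two become the equations relating
   [l], [x] and [y]. *)
have := lv (@Ordinal 4 0 isT); have := lv (@Ordinal 4 1 isT).
have := lv (@Ordinal 4 2 isT); have := lv (@Ordinal 4 3 isT).
rewrite !ffunE /= => E2 E1 y'E x'E; subst x' y'.
rewrite -f_id; apply/eqP.
rewrite /trace_q6_q2 !(expr_exp_iter fE) -!fE /= in trX trY trX' trY' E1 E2.
apply: (scalar_Frobenius_fixed L f l x y ch2 f6 _ trX trY trX' trY') => //.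
- move=> P Q fP fQ; apply: (quadratic_neq_of_fixed L h) => //;
    by rewrite -q_def -fE.
- rewrite -negb_and; apply: contra v0 => /andP[/eqP-> /eqP->].
  apply/eqP/ffunP=> -[[|[|[|[|//]]]] lti]; rewrite !ffunE //=.
  all: by rewrite !(expr_exp_iter fE) -?fE /= !rmorph0 addr0.
Qed.
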